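(* Let $F$ be a field of characteristic $2$, let $n$ be a positive integer, and let $\mathfrak b$ be an anisotropic symmetric bilinear form over $F$ with $\dim\mathfrak b<2^{n+1}$. If $[\mathfrak b]\in I^n(F)$, then $\dim\mathfrak b=2^{n+1}-2^i$ for some integer $1\le i\le n+1$.
   Context: A symmetric bilinear form over a field $K$ is a finite-dimensional $K$-vector space $V$ with a non-degenerate symmetric bilinear map $\mathfrak b:V\times V\to K$; it is anisotropic if $\mathfrak b(v,v)\ne0$ for all $v\ne0$. $W(K)$ is the Witt ring of symmetric bilinear forms over $K$, $[\mathfrak b]$ the class of $\mathfrak b$, $I(K)$ the fundamental ideal (classes of even-dimensional forms) and $I^n(K)$ its $n$-th power. *)

(* Defs.v *)
From HB Require Import structures.
From mathcomp Require Import all_boot all_order all_algebra.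
From mathcomp Require Import mxtens.
From Stdlib Require Lists.List.
Set Implicit Arguments.
Unset Strict Implicit.
Unset Printing Implicit Defensive.
Import GRing.Theory.
Local Open Scope ring_scope.

(* a bilinear form on F^bdim, given by its Gram matrix *)
Record bform (F : fieldType) := BForm { bdim : nat; bmat : 'M[F]_bdim }.

Section Forms.
Variable F : fieldType.

Definition is_form (b : bform F) : Prop :=
  (bmat b)^T = bmat b /\ bmat b \in unitmx.

Definition anisotropic (b : bform F) : Prop :=
  forall v : 'rV[F]_(bdim b), v != 0 -> (v *m bmat b *m v^T) 0 0 != 0.

Definition isometric (b c : bform F) : Prop :=
  exists (P : 'M[F]_(bdim b, bdim c)) (Q : 'M[F]_(bdim c, bdim b)),
    [/\ P *m Q = 1%:M, Q *m P = 1%:M & P *m bmat c *m P^T = bmat b].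

(* metabolic: non-degenerate symmetric form with a Lagrangian W = W^perp *)
Definition metabolic (b : bform F) : Prop :=
  is_form b /\
  exists L : 'M[F]_(bdim b), (L == kermx (bmat b *m L^T))%MS.

Definition oplus (b c : bform F) : bform F :=
  BForm (block_mx (bmat b) 0 0 (bmat c)).
Definition otimes (b c : bform F) : bform F :=
  BForm (bmat b *t bmat c).

Definition zero_form : bform F := @BForm F 0 0.
Definition one_form : bform F := @BForm F 1 1.

Definition witt_equiv (b c : bform F) : Prop :=
  exists M1 M2, metabolic M1 /\ metabolic M2 /\ isometric (oplus b M1) (oplus c M2).

(* representatives of elements of the fundamental ideal I(F) *)
Definition in_I (b : bform F) : Prop := is_form b /\ ~~ odd (bdim b).

Definition in_In (n : nat) (b : bform F) : Prop :=
  exists s : seq (seq (bform F)),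
    (forall t, Stdlib.Lists.List.In t s -> size t = n /\ forall c, Stdlib.Lists.List.In c t -> in_I c) /\
    witt_equiv b (foldr oplus zero_form (map (foldr otimes one_form) s)).

End Forms.

(* Main.v *)
(* Write K = F^2.  A form with Gram matrix B and C = B^-1 gives a tensor
   sum_ij C_ij^2 B_ii (x) B_jj in F (x)_K F; this assignment is a ring
   homomorphism on the Witt ring sending I(F) into the kernel of the
   multiplication map, so a class in I^n(F) lands in the n-th power of that
   kernel.  Letting F (x)_K F act on K-linear maps f : F -> F, this says that the
   tensor lowers the order of f, as a differential operator, by n.
     If b is anisotropic, the B_ii are linearly independent over K.  Choose a
   subfield M of F containing K, maximal with the B_ii still independent over M.
   By maximality every element of F is a product of two elements of the M-span of
   the B_ii, and a dimension count on this bilinear map gives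
   [F : M] = 2^t <= 2 dim b, whence t <= n + 1.  A nonzero M-linear f : F -> M has
   order at most t, so the tensor turns it into an operator P of order at most
   t - n <= 1, whose kernel has M-dimension 2^t - dim b.  The kernel of an operator
   of order at most 1 is zero or a multiple of a subfield, so its dimension is 0
   or a power of 2. *)

Require Import Defs.
From Stdlib Require Import Classical.
From HB Require Import structures.
From mathcomp Require Import all_boot all_order all_algebra.
From mathcomp Require Import falgebra fieldext mpoly mxtens zify ring.
From mathcomp Require boolp classical_sets.
Set Implicit Arguments.
Unset Strict Implicit.
Unset Printing Implicit Defensive.
Import GRing.Theory.
Local Open Scope ring_scope.

(** * The tensor of a bilinear form *)

Section Order.
Variable R : comNzRingType.

(* Differential operators of order [< k], in Grothendieck's sense. *)
Fixpoint order_lt (k : nat) (f : R -> R) : Prop :=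
  if k is k'.+1 then forall a, order_lt k' (fun x => f (a * x) - a * f x)
  else forall x, f x = 0.

Lemma eq_order_lt k (f g : R -> R) : f =1 g -> order_lt k f -> order_lt k g.
Proof.
elim: k f g => [|k IHk] f g fg /=; first by move=> f0 x; rewrite -fg.
by move=> fk a; apply: IHk (fk a) => x; rewrite !fg.
Qed.

Lemma order_lt0 k : order_lt k (fun=> 0).
Proof.
by elim: k => //= k IHk a; apply: eq_order_lt IHk => x; rewrite mulr0 subrr.
Qed.

Lemma order_ltS k f : order_lt k f -> order_lt k.+1 f.
Proof.
elim: k f => [|k IHk] f fk.
  by move=> a x; rewrite !fk mulr0 subrr.
by move=> a; apply: IHk; apply: fk.
Qed.

Lemma order_lt_leq k l f : (k <= l)%N -> order_lt k f -> order_lt l f.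
Proof.
by move=> /subnK <-; elim: (l - k)%N => // d IHd fk; apply/order_ltS/IHd.
Qed.

Lemma order_lt_lin k c f g :
  order_lt k f -> order_lt k g -> order_lt k (fun x => c * f x + g x).
Proof.
elim: k f g => [|k IHk] f g /= fk gk; first by move=> x; rewrite fk gk mulr0 addr0.
move=> a; apply: eq_order_lt (IHk _ _ (fk a) (gk a)) => x.
by rewrite mulrBr mulrDr opprD addrACA [a * (c * _)]mulrCA.
Qed.

Lemma order_lt_sum k (I : finType) (c : I -> R) (f : I -> R -> R) :
  (forall i, order_lt k (f i)) ->
  order_lt k (fun x => \sum_i c i * f i x).
Proof.
move=> fk; have: order_lt k (fun x => \sum_(i <- enum I) c i * f i x).
  elim: (enum I) => [|i s IHs].
    by apply: eq_order_lt (order_lt0 k) => x; rewrite big_nil.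
  by apply: eq_order_lt (order_lt_lin (c i) (fk i) IHs) => x; rewrite big_cons.
by apply: eq_order_lt => x; rewrite big_enum.
Qed.

End Order.

Lemma invmx_unique (K : comUnitRingType) n (A B : 'M[K]_n) :
  A *m B = 1%:M -> invmx A = B.
Proof.
move=> AB1; have [uA _] := mulmx1_unit AB1.
by rewrite -[RHS]mul1mx -(mulVmx uA) -mulmxA AB1 mulmx1.
Qed.

Lemma tensmx11 (K : pzRingType) m n : 1%:M *t 1%:M = 1%:M :> 'M[K]_(m * n).
Proof.
apply/matrixP=> i j.
case: (mxtens_indexP i) => i1 i2; case: (mxtens_indexP j) => j1 j2.
rewrite tensmxE !mxE (inj_eq (can_inj (@mxtens_indexK _ _))) xpair_eqE.
by rewrite -natrM mulnb.
Qed.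

Lemma invmx_tens (K : comUnitRingType) m n (A : 'M[K]_m) (B : 'M[K]_n) :
  A \in unitmx -> B \in unitmx -> invmx (A *t B) = invmx A *t invmx B.
Proof.
move=> uA uB; apply: invmx_unique.
by rewrite tensmx_mul !mulmxV // tensmx11.
Qed.

Lemma big_mxtens (K : nmodType) m n (f : 'I_(m * n) -> K) :
  \sum_i f i = \sum_i \sum_j f (mxtens_index (i, j)).
Proof.
rewrite pair_bigA (reindex (@mxtens_index m n)) /=; first by apply: eq_bigr => -[].
by exists (@mxtens_unindex m n) => i _; rewrite ?mxtens_indexK ?mxtens_unindexK.
Qed.

Section TensorAction.
Variable F : fieldType.
Hypothesis F2 : 2%N \in [pchar F].

(* The tensor sum_ij C_ij^2 B_ii (x) B_jj acting on f. *)
Definition tensor_act (b : bform F) (f : F -> F) (x : F) : F :=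
  \sum_i \sum_j invmx (bmat b) i j ^+ 2 * bmat b i i * f (bmat b j j * x).

(** Linearity over the subfield of squares in a single identity; [c = 1] gives additivity. *)
Definition sq_linear (f : F -> F) :=
  forall c x y, f (c ^+ 2 * x + y) = c ^+ 2 * f x + f y.

Lemma sq_linear0 f : sq_linear f -> f 0 = 0.
Proof.
move=> fl; have := fl 1 0 0; rewrite expr1n !mul1r addr0 => /eqP.
by rewrite -subr_eq subrr eq_sym => /eqP.
Qed.

Lemma sq_linear_sum f (I : finType) (c : I -> F) (y : I -> F) : sq_linear f ->
  f (\sum_i c i ^+ 2 * y i) = \sum_i c i ^+ 2 * f (y i).
Proof.
move=> fl; rewrite -!big_enum; elim: (enum I) => [|i s IHs].
  by rewrite !big_nil sq_linear0.
by rewrite !big_cons fl IHs.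
Qed.

Lemma sqrDF (x y : F) : (x + y) ^+ 2 = x ^+ 2 + y ^+ 2.
Proof. exact: (pFrobenius_autD_comm F2 (mulrC x y)). Qed.

(** The terms at [(k, l)] and [(l, k)] are equal, so off the diagonal they cancel in pairs in
    characteristic 2. *)
Lemma sum_symmetric n (G : 'I_n -> 'I_n -> F) : (forall k l, G l k = G k l) ->
  \sum_k \sum_l G k l = \sum_k G k k.
Proof.
move=> Gs; have cancel_sum (s : seq 'I_n) :
    \sum_(k <- s) \sum_(l <- s) G k l = \sum_(k <- s) G k k.
  elim: s => [|a s IHs]; first by rewrite !big_nil.
  rewrite !big_cons.
  under [X in _ + X = _]eq_bigr => k _ do rewrite big_cons.
  rewrite big_split /= IHs.
  under [X in _ + _ + (X + _)]eq_bigr => k _ do rewrite Gs.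
  by rewrite addrA -[G a a + _ + _]addrA addrr_pchar2 ?addr0.
exact: cancel_sum.
Qed.

(** The cross terms of the quadratic form [v A v^T] cancel, leaving a sum of squares times diagonal
    entries. Thus a change of basis acts on the diagonal of a Gram matrix through the Frobenius
    image of [P]. *)
Lemma diag_congr m n (P : 'M[F]_(m, n)) (A : 'M[F]_n) i : A^T = A ->
  (P *m A *m P^T) i i = \sum_k P i k ^+ 2 * A k k.
Proof.
move=> As; rewrite mxE.
transitivity (\sum_(k < n) \sum_(l < n) P i k * A k l * P i l).
  rewrite exchange_big; apply: eq_bigr => l _; rewrite !mxE mulr_suml.
  by apply: eq_bigr => k _.
pose G k l := P i k * A k l * P i l.
have Gs k l : G l k = G k l.
  have -> : G l k = P i l * A k l * P i k by rewrite /G -[in A l k]As mxE.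
  by rewrite mulrAC [P i l * P i k]mulrC mulrAC.
rewrite (sum_symmetric Gs); apply: eq_bigr => k _.
by rewrite mulrAC.
Qed.

Definition sqmx m n (A : 'M[F]_(m, n)) : 'M[F]_(m, n) := map_mx (pFrobenius_aut F2) A.

Lemma tensor_actE b f x : tensor_act b f x =
  ((\row_i bmat b i i) *m sqmx (invmx (bmat b)) *m \col_j f (bmat b j j * x)) 0 0.
Proof.
rewrite /tensor_act exchange_big mxE; apply: eq_bigr => j _ /=.
rewrite !mxE mulr_suml; apply: eq_bigr => i _; rewrite !mxE.
by rewrite [bmat b i i * _]mulrC.
Qed.

(** The row and the column of diagonals are both transformed by [sqmx P], the inverse Gram matrix by
    [sqmx Q]. These factors cancel because Frobenius is a ring morphism, so it respects matrix
    products. *)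
Lemma tensor_act_isometric b c f : is_form c -> isometric b c -> sq_linear f ->
  tensor_act b f =1 tensor_act c f.
Proof.
case=> cs cu [P [Q [PQ QP bE]]] fl x; rewrite !tensor_actE.
have invb : invmx (bmat b) = Q^T *m invmx (bmat c) *m Q.
  have bu : bmat b *m (Q^T *m invmx (bmat c) *m Q) = 1%:M.
    rewrite -bE -!mulmxA (mulmxA P^T) -trmx_mul QP trmx1 mul1mx.
    by rewrite (mulmxA (bmat c)) mulmxV // mul1mx.
  exact: invmx_unique.
have rowE : \row_i bmat b i i = (\row_i bmat c i i) *m (sqmx P)^T.
  apply/rowP=> i; rewrite !mxE -bE diag_congr //.
  by apply: eq_bigr => k _; rewrite !mxE mulrC.
have colE : \col_j f (bmat b j j * x) = sqmx P *m \col_j f (bmat c j j * x).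
  apply/colP=> i; rewrite !mxE -bE diag_congr // mulr_suml.
  under eq_bigr => k _ do rewrite -mulrA.
  by rewrite sq_linear_sum //; apply: eq_bigr => k _; rewrite !mxE.
have invbE : sqmx (invmx (bmat b)) = (sqmx Q)^T *m sqmx (invmx (bmat c)) *m sqmx Q.
  by rewrite invb /sqmx !map_mxM map_trmx.
have sqQP : sqmx Q *m sqmx P = 1%:M by rewrite -map_mxM QP map_mx1.
rewrite rowE colE invbE -!mulmxA (mulmxA (sqmx Q)) sqQP mul1mx.
by rewrite (mulmxA (sqmx P)^T) -trmx_mul sqQP trmx1 mul1mx.
Qed.

Lemma tensor_act_oplus b c f x : is_form b -> is_form c ->
  tensor_act (oplus b c) f x = tensor_act b f x + tensor_act c f x.
Proof.
case=> _ bu [_ cu]; rewrite !tensor_actE /=.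
have -> : invmx (block_mx (bmat b) 0 0 (bmat c)) =
          block_mx (invmx (bmat b)) 0 0 (invmx (bmat c)).
  have e : block_mx (bmat b) 0 0 (bmat c) *m
           block_mx (invmx (bmat b)) 0 0 (invmx (bmat c)) = 1%:M.
    rewrite mulmx_block !mul0mx !mulmx0 !addr0 !add0r !mulmxV //.
    by rewrite -scalar_mx_block.
  exact: invmx_unique.
rewrite /sqmx map_block_mx !map_mx0.
set B := block_mx (bmat b) 0 0 (bmat c).
have -> : \row_i B i i = row_mx (\row_i bmat b i i) (\row_i bmat c i i).
  apply/rowP=> i; case: (splitP i) => j ij.
    have -> : i = lshift _ j by apply: val_inj.
    by rewrite row_mxEl mxE [RHS]mxE /B block_mxEul.
  have -> : i = rshift _ j by apply: val_inj.
  by rewrite row_mxEr mxE [RHS]mxE /B block_mxEdr.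
have -> : \col_i f (B i i * x) =
    col_mx (\col_i f (bmat b i i * x)) (\col_i f (bmat c i i * x)).
  apply/colP=> i; case: (splitP i) => j ij.
    have -> : i = lshift _ j by apply: val_inj.
    by rewrite col_mxEu mxE [RHS]mxE /B block_mxEul.
  have -> : i = rshift _ j by apply: val_inj.
  by rewrite col_mxEd mxE [RHS]mxE /B block_mxEdr.
by rewrite mul_row_block !mulmx0 addr0 add0r mul_row_col mxE.
Qed.

Lemma tensor_act_otimes b c f x : is_form b -> is_form c ->
  tensor_act (otimes b c) f x = tensor_act b (tensor_act c f) x.
Proof.
case=> _ bu [_ cu]; rewrite /tensor_act /= invmx_tens // big_mxtens.
apply: eq_bigr => i _; under [X in X = _]eq_bigr => k _ do rewrite big_mxtens.
rewrite exchange_big; apply: eq_bigr => j _ /=.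
rewrite mulr_sumr; apply: eq_bigr => k _; rewrite mulr_sumr; apply: eq_bigr => l _.
rewrite !tensmxE -[_ * _ * x]mulrA [bmat b j j * (_ * _)]mulrCA; ring.
Qed.

(* If L = L^perp then C = L^T U^T + W L for some U and W: with Pi a projector onto
   the row space of L, the rows of (1 - Pi^T) C are orthogonal to L.  Both terms
   are killed since the diagonal of L B L^T vanishes. *)
Lemma tensor_act_metabolic b f x : metabolic b -> sq_linear f ->
  tensor_act b f x = 0.
Proof.
move=> [[bs bu] [L /andP[Lsub subL]]] fl; rewrite tensor_actE.
set B := bmat b in bs bu Lsub subL *; set C := invmx B.
have Cs : C^T = C by rewrite /C trmx_inv bs.
have LBL : L *m B *m L^T = 0 by rewrite -mulmxA; apply/sub_kermxP.
pose Pi := proj_mx <<L>>%MS (<<L>>^C)%MS.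
have LPi : L *m Pi = L by apply: proj_mx_id; rewrite ?genmxE ?capmx_compl.
have [W CPi] : exists W, C *m Pi = W *m L.
  by apply/submxP; rewrite (submx_trans (proj_mx_sub _ _ _)) ?genmxE.
have [U CU] : exists U, (1%:M - Pi^T) *m C = U *m L.
  apply/submxP/(submx_trans _ subL)/sub_kermxP.
  rewrite -mulmxA (mulmxA C) mulVmx // mul1mx mulmxBl mul1mx -trmx_mul LPi subrr //.
have CE : C = L^T *m U^T + W *m L.
  rewrite -CPi -trmx_mul -CU trmx_mul Cs linearB /= trmx1 trmxK mulmxBr mulmx1.
  by rewrite subrK.
have yL : (\row_i B i i) *m sqmx L^T = 0.
  apply/rowP=> k; have := congr1 (fun M : 'M_ _ => M k k) LBL.
  rewrite diag_congr // !mxE => LBLk; rewrite -[RHS]LBLk.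
  by apply: eq_bigr => j _; rewrite !mxE mulrC.
have Lz : sqmx L *m (\col_j f (B j j * x)) = 0.
  apply/colP=> k; have := congr1 (fun M : 'M_ _ => M k k) LBL.
  rewrite diag_congr // !mxE => LBLk.
  transitivity (f ((\sum_j L k j ^+ 2 * B j j) * x)); last first.
    by rewrite LBLk mul0r sq_linear0.
  rewrite mulr_suml; under [in RHS]eq_bigr => j _ do rewrite -mulrA.
  by rewrite sq_linear_sum //; apply: eq_bigr => j _; rewrite !mxE.
rewrite CE /sqmx map_mxD !map_mxM -/(sqmx L) -/(sqmx L^T) mulmxDr mulmxDl !mulmxA yL.
by rewrite !mul0mx add0r -!mulmxA Lz !mulmx0 mxE.
Qed.

Lemma tensor_act_one f : tensor_act (one_form F) f =1 f.
Proof.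
by move=> x; rewrite /tensor_act /= !big_ord1 invmx1 !mxE expr1n !mul1r.
Qed.

Lemma tensor_act_zero f x : tensor_act (zero_form F) f x = 0.
Proof. exact: big_ord0. Qed.

(** This is the image of the tensor under multiplication. With [C = C B C^T], [diag_congr] collapses
    the sum over [j] to [C i i]; what remains is the diagonal part of the trace of [B C = 1], whose
    off-diagonal part cancels by symmetry. *)
Lemma tensor_trace (b : bform F) : is_form b ->
  \sum_i \sum_j invmx (bmat b) i j ^+ 2 * bmat b i i * bmat b j j =
  (bdim b)%:R :> F.
Proof.
case=> bs bu; set C := invmx _.
have Cs : C^T = C by rewrite /C trmx_inv bs.
have CE i : C i i = \sum_j C i j ^+ 2 * bmat b j j.
  by rewrite -(diag_congr _ _ bs) Cs /C mulVmx // mul1mx.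
transitivity (\sum_i bmat b i i * C i i).
  apply: eq_bigr => i _; rewrite CE mulr_sumr; apply: eq_bigr => j _.
  by rewrite mulrCA mulrA.
have -> : (bdim b)%:R = \tr (bmat b *m C) by rewrite mulmxV // mxtrace1.
rewrite /mxtrace; under [RHS]eq_bigr => i _ do rewrite mxE.
rewrite sum_symmetric // => i j.
have entry_sym (A : 'M[F]_(bdim b)) : A^T = A -> A j i = A i j.
  by move=> As; rewrite -[in LHS]As mxE.
by rewrite (entry_sym _ bs) (entry_sym _ Cs).
Qed.

(** By [tensor_trace] and evenness of the dimension, the multiplication map kills the tensor.
    Subtracting this zero multiple of [f] turns the action into a combination of the commutators of
    [f] with the [B_jj], each of lower order. *)
Lemma tensor_act_order k b f : in_I b -> order_lt k.+1 f ->
  order_lt k (tensor_act b f).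
Proof.
case=> fb evb fk.
have even0 : (bdim b)%:R = 0 :> F.
  by apply/eqP; rewrite -(dvdn_pcharf F2) dvdn2.
pose c i j := invmx (bmat b) i j ^+ 2 * bmat b i i.
apply: (@eq_order_lt _ _ (fun x => \sum_i 1 * \sum_j c i j *
    (f (bmat b j j * x) - bmat b j j * f x))) => [x|]; last first.
  by apply: order_lt_sum => i; apply: order_lt_sum => j; apply: fk.
transitivity (tensor_act b f x - (bdim b)%:R * f x); last first.
  by rewrite even0 mul0r subr0.
rewrite -(tensor_trace fb) mulr_suml -sumrB.
apply: eq_bigr => i _; rewrite mul1r mulr_suml -sumrB.
by apply: eq_bigr => j _; rewrite /c mulrBr !mulrA.
Qed.

Lemma is_form_oplus (b c : bform F) : is_form b -> is_form c -> is_form (oplus b c).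
Proof.
move=> [bs bu] [cs cu]; split=> /=; first by rewrite tr_block_mx bs cs !trmx0.
by rewrite unitmxE det_ublock unitrM -!unitmxE bu.
Qed.

Lemma is_form_otimes (b c : bform F) : is_form b -> is_form c -> is_form (otimes b c).
Proof.
move=> [bs bu] [cs cu]; split=> /=; first by rewrite trmx_tens bs cs.
suff /mulmx1_unit[] : (bmat b *t bmat c) *m
    (invmx (bmat b) *t invmx (bmat c)) = 1%:M by [].
by rewrite tensmx_mul !mulmxV // tensmx11.
Qed.

Lemma is_form_one : is_form (one_form F).
Proof. by split; rewrite ?trmx1 ?unitmx1. Qed.

Lemma is_form_zero : is_form (zero_form F).
Proof. by split; [apply/matrixP => -[] | rewrite unitmxE det_mx00 unitr1]. Qed.

Lemma tensor_act_prod (t : seq (bform F)) : (forall c, List.In c t -> in_I c) ->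
  is_form (foldr (@otimes F) (one_form F) t) /\
  forall k f, order_lt (size t + k) f ->
    order_lt k (tensor_act (foldr (@otimes F) (one_form F) t) f).
Proof.
elim: t => [|c t IHt] /= tI.
  split=> [|k f fk]; first exact: is_form_one.
  by apply: eq_order_lt fk => x; rewrite tensor_act_one.
have [tform tord] := IHt (fun c' c't => tI c' (or_intror c't)).
have cI : in_I c by apply: tI; left.
split=> [|k f]; first by apply: is_form_otimes => //; case: cI.
move=> fk; have /tord/(tensor_act_order cI) : order_lt (size t + k.+1) f.
  by rewrite addnS.
apply: eq_order_lt => x.
by rewrite tensor_act_otimes //; case: cI.
Qed.

Lemma tensor_act_sum n (s : seq (seq (bform F))) :
  (forall t, List.In t s -> size t = n /\ forall c, List.In c t -> in_I c) ->
  let b := foldr (@oplus F) (zero_form F) (map (foldr (@otimes F) (one_form F)) s) in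
  is_form b /\ forall k f, order_lt (n + k) f -> order_lt k (tensor_act b f).
Proof.
elim: s => [|t s IHs] /= sI.
  split=> [|k f _]; first exact: is_form_zero.
  by apply: eq_order_lt (order_lt0 _ k) => x; rewrite tensor_act_zero.
have [sform sord] := IHs (fun t' t's => sI t' (or_intror t's)).
have [tn /tensor_act_prod[tform tord]] := sI t (or_introl erefl).
split=> [|k f fk]; first exact: is_form_oplus.
have := order_lt_lin 1 (tord k f _) (sord k f fk); rewrite tn => /(_ fk).
by apply: eq_order_lt => x; rewrite tensor_act_oplus // mul1r.
Qed.

Lemma tensor_act_In n k b f : is_form b -> in_In n b -> sq_linear f ->
  order_lt (n + k) f -> order_lt k (tensor_act b f).
Proof.
move=> fb [s [sI [M1 [M2 [mM1 [mM2 iso]]]]]] fl.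
have [fc cord] := tensor_act_sum sI; set c := foldr _ _ _ in iso fc cord.
have fM1 : is_form M1 by case: mM1.
have fM2 : is_form M2 by case: mM2.
move=> /cord; apply: eq_order_lt => x.
have := tensor_act_isometric (is_form_oplus fc fM2) iso fl x.
rewrite !tensor_act_oplus //.
by rewrite (tensor_act_metabolic _ mM1 fl) (tensor_act_metabolic _ mM2 fl) !addr0 => ->.
Qed.

End TensorAction.

(** * Operators of order at most one *)

Section InseparableExtension.
Variables (L : fieldType) (F : fieldExtType L).
Hypothesis F2 : 2%N \in [pchar F].
Hypothesis sqF : forall x : F, x ^+ 2 \in 1%VS.

(** The minimal polynomial divides ['X^2 - x^2], whose coefficients lie in [U], and it is not of
    degree 1. *)
Lemma dim_adjoin (U : {subfield F}) x : x \notin U ->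
  \dim <<U; x>> = (\dim U * 2)%N.
Proof.
move=> xU; rewrite dim_Fadjoin mulnC; congr (_ * _)%N.
have deg1 : adjoin_degree U x != 1%N by rewrite adjoin_deg_eq1.
have deg0 : (0 < adjoin_degree U x)%N by [].
suff : (adjoin_degree U x <= 2)%N by move: deg0 deg1; case: adjoin_degree => [|[|[|]]].
have pU : 'X^2 - (x ^+ 2)%:P \is a polyOver U.
  rewrite rpredB ?rpredX ?polyOverX // polyOverC.
  by rewrite (subvP (sub1v U)) // sqF.
have : minPoly U x %| 'X^2 - (x ^+ 2)%:P.
  by apply: minPoly_dvdp => //; rewrite /root !hornerE subrr.
move=> /dvdp_leq; rewrite size_minPoly size_XnsubC // ltnS; apply.
by rewrite -size_poly_eq0 size_XnsubC.
Qed.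

Lemma dim_tower (U : {subfield F}) : exists s, \dim {:F} = (\dim U * 2 ^ s)%N.
Proof.
have [k] := ubnP (\dim {:F} - \dim U)%N; elim: k => // k IHk in U *.
have [FU|] := boolP ({:F} <= U)%VS.
  exists 0%N; rewrite muln1; congr (\dim _); apply/eqP.
  by rewrite eqEsubv FU subvf.
case/subvPn=> x _ xU; have dimx := dim_adjoin xU.
have le : (\dim <<U; x>> <= \dim {:F})%N by rewrite dimvS ?subvf.
have U0 := adim_gt0 U.
move=> bound; case: (IHk <<U; x>>%AS); first by rewrite dimx in le *; lia.
by move=> s ->; exists s.+1; rewrite /= dimx expnS mulnA.
Qed.

Lemma adjoin_linear (f : F -> F) (U : {subfield F}) a : {morph f : x y / x + y} ->
  (forall u x, u \in U -> f (u * x) = u * f x) ->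
  (forall x, f (a * x) = a * f x) ->
  forall u x, u \in <<U; a>>%VS -> f (u * x) = u * f x.
Proof.
move=> fD fU fa u x /Fadjoin_polyP[p /polyOverP pU ->].
have f0 : f 0 = 0 by apply: (addrI (f 0)); rewrite -fD !addr0.
have fX i y : f (a ^+ i * y) = a ^+ i * f y.
  by elim: i y => [|i IHi] y; rewrite ?mul1r // exprSr -!mulrA IHi fa.
rewrite horner_coef !mulr_suml (big_morph f fD f0).
by apply: eq_bigr => i _; rewrite -!mulrA fU // fX.
Qed.

(** Each commutator with an element [a] outside [U] is linear over the larger field [U(a)], so every
    step halves the remaining degree, until [f] is [F]-linear and all commutators vanish. *)
Lemma order_lt_linear s (U : {subfield F}) (f : F -> F) :
  \dim {:F} = (\dim U * 2 ^ s)%N -> {morph f : x y / x + y} ->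
  (forall u x, u \in U -> f (u * x) = u * f x) -> order_lt s.+1 f.
Proof.
elim: s U f => [|s IHs] U f dimU fD fU a.
  have FU : {:F}%VS = U.
    by apply/esym/eqP; rewrite eqEdim subvf dimU muln1 leqnn.
  by move=> x; rewrite fU ?subrr // -FU memvf.
have [aU|aU] := boolP (a \in U).
  by apply: eq_order_lt (order_lt0 F s.+1) => x; rewrite fU // subrr.
apply: (IHs <<U; a>>%AS).
- by rewrite /= dim_adjoin // dimU expnS mulnA.
- by move=> x y; rewrite mulrDr !fD mulrDr opprD addrACA.
- apply: adjoin_linear => [x y|u x uU|x].
  + by rewrite mulrDr !fD mulrDr opprD addrACA.
  + by rewrite [a * (u * x)]mulrCA !(fU u _ uU) mulrBr [a * (u * _)]mulrCA.
  (* For [g x = f (a * x) - a * f x] one finds [g (a * x) = a^2 * f x - a * f (a * x) = - a * g x],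
     and the sign disappears in characteristic 2. *)
  have a2U : a ^+ 2 \in U by rewrite (subvP (sub1v U)) // sqF.
  rewrite !mulrA -expr2 fU // mulrBr [a * (a * _)]mulrA -expr2.
  by rewrite -opprB oppr_pchar2.
Qed.

Variables (m : nat) (d : 'I_m -> F).
Hypothesis freed : forall c : 'I_m -> L, \sum_i c i *: d i = 0 -> forall i, c i = 0.

Section Functional.
Variable l : {linear F -> L^o}.
Hypothesis l_neq0 : exists x, l x != 0.

Definition pairing (y : F) : F -> 'rV[L]_m := fun x => \row_j l (d j * (y * x)).

Lemma pairing_is_linear y : linear (pairing y).
Proof.
move=> c u v; apply/rowP=> j; rewrite !mxE.
by rewrite mulrDr -scalerAr mulrDr -scalerAr linearP.
Qed.
HB.instance Definition _ y := GRing.isLinear.Build _ _ _ _ (pairing y) (pairing_is_linear y).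

(** The pairing is onto [L^m]. A relation [v] among its components gives [z = sum_j v_j d_j] with
    [l (z * (y * w)) = 0] for all [w]; as [l] is nonzero this forces [z = 0], and then [v = 0] by
    independence of the [d_j]. *)
Lemma dim_lker_pairing y : y != 0 -> (\dim (lker (linfun (pairing y))) + m = \dim {:F})%N.
Proof.
move=> y0; set ev := linfun _.
pose e := vbasis {:F}; pose G := \matrix_(i < \dim {:F}) ev e`_i.
suff Gfull : row_full G.
  have limg_full : limg ev = fullv.
    apply/eqP; rewrite eqEsubv subvf; apply/subvP=> v _.
    have /submxP[w ->] : (v <= G)%MS by apply: submx_full.
    have -> : w *m G = ev (\sum_i w 0 i *: e`_i).
      rewrite linear_sum; apply/rowP => j; rewrite mxE summxE.
      by apply: eq_bigr => i _; rewrite linearZ !mxE.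
    by apply: memv_img; rewrite memvf.
  rewrite -(limg_ker_dim ev fullv) capfv limg_full dimvf /=.
  by rewrite /dim /= mul1n.
rewrite -[row_full G]/(\rank G == m) -mxrank_tr -/(row_free G^T) -kermx_eq0.
apply/rowV0P=> v /sub_kermxP vG; pose z := \sum_j v 0 j *: d j.
suff z0 : z = 0 by apply/rowP=> j; rewrite mxE (freed z0).
apply/eqP; apply: contraT => z0; case: l_neq0 => x; case/negP; apply/eqP.
have lz w : l (z * (y * w)) = 0.
  rewrite (coord_vbasis (memvf w)) !mulr_sumr linear_sum big1 // => i _.
  rewrite -!scalerAr linearZ /=.
  have := congr1 (fun M : 'rV_ _ => M 0 i) vG; rewrite !mxE => vGi.
  rewrite /z mulr_suml linear_sum /=.
  under eq_bigr => j _ do rewrite -scalerAl linearZ.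
  suff -> : \sum_(j < m) v 0 j *: l (d j * (y * e`_i)) = 0 by rewrite scaler0.
  rewrite -[RHS]vGi.
  by apply: eq_bigr => j _; rewrite !mxE lfunE /= mxE.
by have := lz (y^-1 * (z^-1 * x)); rewrite mulVKf // mulVKf.
Qed.

End Functional.

(** Here [C] plays the role of the entrywise squares of the inverse Gram matrix and [d] that of its
    diagonal. The last hypothesis says that the tensor lowers the order by [n]. *)
Lemma dim_gap n (C : 'M[L]_m) : C \in unitmx -> (0 < n)%N -> (m < 2 ^ n.+1)%N ->
  ~~ odd m -> (\dim {:F} <= 2 * m)%N ->
  (forall k f, linear f -> order_lt (n + k) f ->
    order_lt k (fun x : F => \sum_i \sum_j (C i j)%:A * d i * f (d j * x))) ->
  exists i, [/\ (1 <= i)%N, (i <= n.+1)%N & m = (2 ^ n.+1 - 2 ^ i)%N].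
Proof.
move=> uC n0 ltm evm dimF drop.
have [t] := dim_tower 1%AS; rewrite dimv1 mul1n => dimFt.
have dimF0 : (0 < \dim {:F})%N by rewrite dimFt expn_gt0.
have [l l_neq0] : exists l : {linear F -> L^o}, exists x, l x != 0.
  exists (coord (vbasis {:F}) (Ordinal dimF0)), (vbasis {:F})`_(Ordinal dimF0).
  have lE := coord_free (Ordinal dimF0) (Ordinal dimF0) (basis_free (vbasisP {:F})).
  by rewrite [X in X != _]lE eqxx oner_eq0.
pose f x : F := (l x)%:A.
have flin : linear f by move=> c x y; rewrite /f linearP scalerDl scalerA.
have ford : order_lt t.+1 f.
  apply: (@order_lt_linear _ 1%AS); first by rewrite dimv1 mul1n.
    by move=> x y; rewrite /f linearD scalerDl.
  move=> u x /vlineP[c ->]; rewrite /f -scalerAl mul1r linearZ /=.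
  by rewrite -scalerAl mul1r scalerA.
pose P (x : F) : F := \sum_i \sum_j (C i j)%:A * d i * f (d j * x).
(* The coefficients of [P (y * x)] on the independent [d_i] are [C] applied to the pairing, and [C]
   is invertible. *)
have PE y x : P (y * x) = 0 <-> pairing l y x = 0.
  have -> : P (y * x) = \sum_i (C *m (pairing l y x)^T) i 0 *: d i.
    apply: eq_bigr => i _; rewrite mxE scaler_suml; apply: eq_bigr => j _.
    rewrite !mxE /f -scalerAl mul1r -scalerAl -scalerAr mulr1 scalerA.
    by [].
  split=> [/freed c0|->]; last first.
    by rewrite trmx0 mulmx0 big1 // => i _; rewrite mxE scale0r.
  apply: trmx_inj; rewrite trmx0 -(mulKmx uC (pairing l y x)^T).
  suff -> : C *m (pairing l y x)^T = 0 by rewrite mulmx0.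
  by apply/colP => i; rewrite c0 mxE.
have kerE y x : x \in lker (linfun (pairing l y)) <-> P (y * x) = 0.
  by rewrite PE memv_ker lfunE; split=> /eqP.
have dimker y : y != 0 -> (\dim (lker (linfun (pairing l y))) + m = 2 ^ t)%N.
  by move=> y0; rewrite dim_lker_pairing.
have P0m : (forall x, P x = 0) -> m = 0%N.
  move=> P0; have := dimker 1 (oner_neq0 _).
  suff -> : lker (linfun (pairing l 1)) = fullv by rewrite dimFt; lia.
  apply/eqP; rewrite eqEsubv subvf; apply/subvP => x _.
  by apply/kerE; rewrite P0.
have [m0|m0] := eqVneq m 0%N.
  by exists n.+1; rewrite subnn.
have lett : (t <= n.+1)%N.
  by rewrite -ltnS -(ltn_exp2l _ _ (ltnSn 1)) expnS; lia.
have [[y y0 Py]|Pinj] : (exists2 y, y != 0 & P y = 0) \/ (forall y, P y = 0 -> y = 0).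
  pose K := lker (linfun (pairing l 1)).
  have KE y : y \in K <-> P y = 0 by rewrite kerE mul1r.
  have [K0|K0] := eqVneq K 0%VS; last first.
    left; exists (vpick K); first by rewrite vpick0.
    exact/KE/memv_pick.
  by right=> y /KE; rewrite K0 memv0 => /eqP.
- have := dimker y y0; set Z := lker _ => dimZ.
  have [tn|] := leqP t n.
    (* Order 0 means [F]-linear, and an [F]-linear map killing [y != 0] is zero. *)
    have Plin : order_lt 1 P by apply: drop; rewrite // addn1; apply: order_lt_leq ford.
    case/eqP: m0; apply: P0m => x; have /eqP := Plin (x * y^-1) y.
    by rewrite mulfVK // Py mulr0 subr0 => /eqP.
  move=> ltnt; have {lett ltnt} tE : t = n.+1 by lia.
  have P2 : order_lt 2 P by apply: drop; rewrite // addn2 -tE.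
  have Z1 : 1 \in Z by apply/kerE; rewrite mulr1.
  (* [Z] consists of the [x] with [P (y * x) = 0]. The double commutator of [P] with [u] and [v],
     evaluated at [y], vanishes; since [P] kills [y], [u * y] and [v * y], it reduces to
     [P (u * v * y) = 0]. *)
  have ZM : (Z * Z <= Z)%VS.
    apply/prodvP => u v /kerE; rewrite mulrC => Pu /kerE; rewrite mulrC => Pv.
    apply/kerE; have /eqP := P2 u v y; rewrite /= Pv Py Pu !mulr0 !subr0 mulr0 subr0.
    by rewrite mulrA [u * v * y]mulrC => /eqP.
  have Zasp : is_aspace Z by rewrite /is_aspace has_algid1.
  have [s dimFs] := dim_tower (ASpace Zasp).
  have : (\dim Z %| 2 ^ t)%N by rewrite -dimFt dimFs dvdn_mulr.
  move=> /(dvdn_pfactor _ _ (isT : prime 2))[i leit dimZi].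
  exists i; split.
  (* For [i = 0] the dimension [m = 2^(n+1) - 1] would be odd. *)
  + rewrite lt0n; apply: contraNneq evm => i0.
    have := congr1 odd dimZ; rewrite dimZi i0 tE oddD [RHS]oddX /=.
    by case: (odd m).
  + by rewrite -tE.
  by rewrite -tE -dimZ dimZi addKn.
- have K0 : lker (linfun (pairing l 1)) = 0%VS.
    apply/eqP; rewrite -subv0; apply/subvP => y /kerE; rewrite mul1r => /Pinj ->.
    exact: mem0v.
  have := dimker 1 (oner_neq0 _); rewrite K0 dimv0 add0n => mE.
  (* Injectivity gives [m = 2^t]. If [t < n] then [P] would be zero; otherwise the bound on [m]
     forces [t = n], and the witness is [i = n]. *)
  have [ltn|] := ltnP t n.
    have P0 : order_lt 0 P by apply: drop; rewrite // addn0; apply: order_lt_leq ford.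
    by case/eqP: m0; apply: P0m.
  move=> len; have tE : t = n.
    by apply/eqP; rewrite eqn_leq len andbT -ltnS -(ltn_exp2l _ _ (ltnSn 1)) -mE.
  by exists n; split=> //; rewrite mE tE expnS; lia.
Qed.

End InseparableExtension.

(** * Counting dimensions of products *)

(** Uniqueness of base [e] digits. It keeps distinct monomials with exponents below [e] distinct
    after the substitution [y_i = s^(e^i)]. *)
Lemma digits_inj e c (f g : 'I_c -> nat) :
  (forall i, f i < e)%N -> (forall i, g i < e)%N ->
  (\sum_i f i * e ^ i = \sum_i g i * e ^ i)%N -> f =1 g.
Proof.
elim: c f g => [|c IHc] f g fe ge; first by move=> _ [].
rewrite !big_ord_recl !expn0 !muln1.
have e0 : (0 < e)%N by apply: leq_ltn_trans (fe ord0).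
have tail (h : 'I_c.+1 -> nat) : (\sum_(i < c) h (lift ord0 i) * e ^ lift ord0 i =
    (\sum_(i < c) h (lift ord0 i) * e ^ i) * e)%N.
  by rewrite big_distrl; apply: eq_bigr => i _; rewrite /= /bump expnSr mulnA.
rewrite !tail => fg.
have fg0 : f ord0 = g ord0.
  by have := congr1 (modn^~ e) fg; rewrite !(addnC (f _)) !(addnC (g _)) !modnMDl !modn_small.
have fgS : (fun i => f (lift ord0 i)) =1 (fun i => g (lift ord0 i)).
  apply: IHc => //.
  by apply/eqP; rewrite -(eqn_pmul2r e0); apply/eqP; move: fg; rewrite fg0 => /addnI.
by move=> i; case: (unliftP ord0 i) => [j|] ->; [exact: fgS | exact: fg0].
Qed.

Section PolynomialMaps.
Variables (L : fieldType) (a c : nat) (p : 'I_c -> {mpoly L[a]}).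

(** [msize] is the degree plus one for nonzero polynomials and 0 for zero; the inequality also
    covers zero factors. *)
Lemma msizeM_pred (q r : {mpoly L[a]}) : (msize (q * r) <= (msize q + msize r).-1)%N.
Proof.
have [->|q0] := eqVneq q 0; first by rewrite mul0r msize0.
have [->|r0] := eqVneq r 0; first by rewrite mulr0 msize0.
by rewrite msizeM.
Qed.

Lemma msize_exp_le (q : {mpoly L[a]}) D k :
  (msize q <= D.+1)%N -> (msize (q ^+ k) <= (k * D).+1)%N.
Proof.
move=> qD; elim: k => [|k IHk]; first by rewrite expr0 msize1.
by rewrite exprS mulSn; apply: leq_trans (msizeM_pred _ _) _; lia.
Qed.

Lemma msize_prod_le (I : finType) (q : I -> {mpoly L[a]}) D :
  (forall i, msize (q i) <= D.+1)%N -> (msize (\prod_i q i) <= (#|I| * D).+1)%N.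
Proof.
move=> qD; rewrite -big_enum cardE; elim: (enum I) => [|i s IHs].
  by rewrite big_nil msize1.
by rewrite big_cons [size _]/= mulSn; apply: leq_trans (msizeM_pred _ _) _; have := qD i; lia.
Qed.

Lemma card_bmultinom B : (#|{: 'X_{1..a < B}}| <= B ^ a)%N.
Proof.
have lt_B (m : 'X_{1..a < B}) i : (m i < B)%N.
  by apply: leq_ltn_trans (bmdeg m); rewrite mdegE (bigD1 i) //= leq_addr.
pose h (m : 'X_{1..a < B}) : {ffun 'I_a -> 'I_B} := [ffun i => Ordinal (lt_B m i)].
have h_inj : injective h.
  move=> m m' /ffunP hm; apply/val_inj/mnmP => i.
  by have := congr1 val (hm i); rewrite !ffunE.
have := max_card (mem (codom h)); rewrite card_ffun !card_ord.
by rewrite (card_codom h_inj).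
Qed.

(** The [e^c] power products have size at most [B], so their coefficient vectors lie in a space of
    dimension at most [B^a < e^c] and are linearly dependent. *)
Lemma algebraic_relation D e : (forall i, msize (p i) <= D.+1)%N ->
  ((c * (e * D)).+1 ^ a < e ^ c)%N ->
  exists2 g : {ffun {ffun 'I_c -> 'I_e} -> L}, g != 0 &
    \sum_(al : {ffun 'I_c -> 'I_e}) g al *: \prod_i p i ^+ al i = 0.
Proof.
move=> pD large; set B := (c * (e * D)).+1 in large.
pose q (al : {ffun 'I_c -> 'I_e}) := \prod_i p i ^+ al i.
have qB al : (msize (q al) <= B)%N.
  rewrite /B -[c in (c * _)%N]card_ord; apply: msize_prod_le => i.
  apply: leq_trans (msize_exp_le (al i) (pD i)) _.
  by rewrite ltnS leq_mul2r ltnW ?orbT.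
pose A := \matrix_(i < #|{ffun 'I_c -> 'I_e}|, j < #|{: 'X_{1..a < B}}|)
  (q (enum_val i))@_(enum_val j).
have : kermx A != 0.
  rewrite kermx_eq0 /row_free neq_ltn.
  apply/orP; left; apply: leq_ltn_trans (rank_leq_col _) _.
  by rewrite card_ffun !card_ord; apply: leq_ltn_trans (card_bmultinom B) large.
case/rowV0Pn=> v /sub_kermxP vA v0.
exists [ffun al => v 0 (enum_rank al)].
  apply: contra_neq v0 => /ffunP g0; apply/rowP => i.
  by have := g0 (enum_val i); rewrite !ffunE enum_valK mxE.
apply/mpolyP => m; rewrite mcoeff0.
have [mB|mB] := ltnP (mdeg m) B; last first.
  rewrite raddf_sum big1 // => al _ /=; rewrite mcoeffZ memN_msupp_eq0 ?mulr0 //.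
  by apply: msize_mdeg_ge; apply: leq_trans (qB al) mB.
have := congr1 (fun M : 'rV_ _ => M 0 (enum_rank (BMultinom mB))) vA.
rewrite !mxE => <-; rewrite raddf_sum /= (reindex_onto enum_val enum_rank) /=; last first.
  by move=> al _; rewrite enum_rankK.
apply: eq_big => [i|i _]; first by rewrite enum_valK eqxx.
by rewrite mcoeffZ ffunE enum_valK mxE enum_rankK.
Qed.

Hypothesis infL : forall N, exists2 rs : seq L, uniq rs & size rs = N.

(* There are more monomials in the p_i with exponents below e than monomials in a
   variables of the corresponding degrees, hence an algebraic relation; on the curve
   y_i = s^(e^i) it becomes a nonzero polynomial in s. *)
Lemma poly_map_not_surjective : (a < c)%N ->
  ~ (forall y : 'I_c -> L, exists v, forall i, (p i).@[v] = y i).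
Proof.
move=> ac surj.
pose D := \max_i msize (p i).
have pD i : (msize (p i) <= D.+1)%N by rewrite leqW // /D (leq_bigmax i).
(* With this [e], [(c e D + 1)^a <= e^a (c D + 1)^a < e^(a+1) <= e^c]. *)
pose e := ((c * D).+1 ^ a).+1.
have large : ((c * (e * D)).+1 ^ a < e ^ c)%N.
  have le : ((c * (e * D)).+1 <= e * (c * D).+1)%N by rewrite /e; nia.
  have le_a : ((c * (e * D)).+1 ^ a <= (e * (c * D).+1) ^ a)%N.
    by elim: (a) => // k IHk; rewrite !expnS leq_mul.
  apply: leq_ltn_trans le_a _; rewrite expnMn.
  apply: (@leq_trans (e ^ a.+1)); last by rewrite leq_pexp2l.
  by rewrite expnSr ltn_pmul2l // expn_gt0.
have [g g0 gq] := algebraic_relation pD large.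
pose N (al : {ffun 'I_c -> 'I_e}) := (\sum_i al i * e ^ i)%N.
have N_inj : injective N.
  move=> al be /digits_inj abE; apply/ffunP => i; apply: val_inj.
  by apply: (abE _ _ i).
pose G : {poly L} := \sum_al g al *: 'X^(N al).
have Groot s : root G s.
  have [v vE] := surj (fun i => s ^+ (e ^ i)).
  have := congr1 (meval v) gq; rewrite meval0 raddf_sum /= => sum0.
  apply/rootP; rewrite -[RHS]sum0 /G horner_sum; apply: eq_bigr => al _.
  rewrite hornerZ hornerXn mevalZ rmorph_prod; congr (_ * _).
  rewrite /N expr_sum; apply: eq_bigr => i _.
  by rewrite rmorphXn /= vE -exprM mulnC.
have G0 : G != 0.
  have [al gal] : exists al, g al != 0.
    apply/existsP; rewrite -negb_forall; apply: contra g0 => /forallP g0.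
    by apply/eqP/ffunP => al; rewrite ffunE; apply/eqP.
  apply: contraNneq gal => /polyP /(_ (N al)); rewrite coef0 coef_sum (bigD1 al) //=.
  rewrite coefZ coefXn eqxx mulr1 big1 ?addr0 => [->//|be neq].
  by rewrite coefZ coefXn (inj_eq N_inj) eq_sym (negPf neq) mulr0.
have [rs urs srs] := infL (size G).
have allr : all (root G) rs by apply/allP => s _.
by have := max_poly_roots G0 allr urs; rewrite srs ltnn.
Qed.

End PolynomialMaps.

Lemma infinite_or_enum (T : eqType) :
  (forall N, exists2 rs : seq T, uniq rs & size rs = N) \/
  (exists2 rs : seq T, uniq rs & forall x, x \in rs).
Proof.
have [enumT|noenum] := classic (exists2 rs : seq T, uniq rs & forall x, x \in rs).
  by right.
left; elim=> [|N [rs urs srs]]; first by exists [::].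
have [x xrs] : exists x, x \notin rs.
  apply: NNPP => all_rs; apply: noenum; exists rs => // x.
  by apply/negPn/negP => xrs; apply: all_rs; exists x.
by exists (x :: rs); rewrite /= ?xrs ?srs.
Qed.

Section Products.
Variables (L : fieldType) (F : fieldExtType L).
Hypothesis F2 : 2%N \in [pchar F].
Hypothesis sqF : forall x : F, x ^+ 2 \in 1%VS.

Lemma sqr_inj_pchar2 (K : fieldType) : 2%N \in [pchar K] ->
  injective (fun x : K => x ^+ 2).
Proof. by move=> K2; apply: (fmorph_inj (pFrobenius_aut K2)). Qed.

(** Squaring is injective on the finite field [L], hence onto. So [x^2] equals [y^2] with [y] in
    [L], and then [x = y]. *)
Lemma finite_base_trivial (rs : seq L) : uniq rs -> (forall x, x \in rs) ->
  \dim {:F} = 1%N.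
Proof.
move=> urs rsT; have L2 : 2%N \in [pchar L] by rewrite -(pchar_lalg F).
have sub : {subset [seq y ^+ 2 | y <- rs] <= rs} by move=> x _.
have := uniq_min_size _ sub; rewrite (map_inj_uniq (sqr_inj_pchar2 L2)) size_map.
move=> /(_ urs (leqnn _))[_ rsE].
suff -> : {:F}%VS = 1%VS by rewrite dimv1.
apply/eqP; rewrite eqEsubv sub1v andbT; apply/subvP => x _.
have /vlineP[l lE] := sqF x.
have : l \in rs by []; rewrite -rsE => /mapP[y _ ly].
have -> : x = y%:A.
  by apply: (sqr_inj_pchar2 F2); rewrite /= lE ly -(rmorphXn (in_alg F)).
by rewrite rpredZ ?mem1v.
Qed.

(** In coordinates, multiplying two combinations of the [d_i] is a polynomial map from [L^(m+m)] to
    [L^(\dim {:F})]. Over an infinite [L] it can be onto only if the target has no larger dimension;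
    a finite [L] gives dimension 1. *)
Lemma dim_le_products m (d : 'I_m -> F) :
  (forall z, exists u w : 'I_m -> L, z = (\sum_i u i *: d i) * (\sum_i w i *: d i)) ->
  (\dim {:F} <= m + m)%N.
Proof.
move=> prodF; have m0 : (0 < m)%N.
  rewrite lt0n; apply/negP => /eqP m0; have [u [w]] := prodF 1.
  rewrite big1 ?mul0r => [/eqP|i _]; first by rewrite oner_eq0.
  by have := ltn_ord i; rewrite [in X in (_ < X)%N]m0 ltn0.
have [infL|[rs urs rsT]] := infinite_or_enum L; last first.
  by rewrite (finite_base_trivial urs rsT) addn_gt0 m0.
rewrite leqNgt; apply/negP => ltF.
pose e := vbasis {:F}.
pose p i : {mpoly L[m + m]} :=
  \sum_k \sum_l coord e i (d k * d l) *: ('X_(lshift m k) * 'X_(rshift m l)).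
apply: (poly_map_not_surjective (p := p) infL ltF) => y.
have [u [w uw]] := prodF (\sum_i y i *: e`_i).
exists (fun j => match split j with inl k => u k | inr l => w l end) => i.
have <- : coord e i (\sum_i y i *: e`_i) = y i.
  by rewrite coord_sum_free // (basis_free (vbasisP _)).
rewrite uw mulr_suml !linear_sum /=; apply: eq_bigr => k _.
rewrite -scalerAl linearZ /= mulr_sumr !linear_sum /=.
rewrite mulr_sumr; apply: eq_bigr => l _.
rewrite mevalZ mevalM !mevalXU (unsplitK (inl k)) (unsplitK (inr l)).
by rewrite -scalerAr linearZ /= mulrCA; ring.
Qed.

End Products.

(** * A maximal subfield *)

Section MaximalSubfield.
Variables (F : fieldType) (m : nat) (d : 'I_m -> F).
Hypothesis F2 : 2%N \in [pchar F].

(* In characteristic 2 a subring containing all squares is a subfield, because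
   x^-1 = x (x^-1)^2. *)
Definition sq_subfield (A : F -> Prop) :=
  [/\ forall x, A (x ^+ 2), forall x y, A x -> A y -> A (x + y)
    & forall x y, A x -> A y -> A (x * y)].

Definition free_over (A : F -> Prop) :=
  forall c : 'I_m -> F, (forall i, A (c i)) -> \sum_i c i * d i = 0 ->
  forall i, c i = 0.

Lemma sq_subfield0 A : sq_subfield A -> A 0.
Proof. by case=> sqA _ _; have := sqA 0; rewrite expr0n. Qed.

(** This is the ring [A[z]] when [A] is a [sq_subfield], since [z^2] is already in [A]. *)
Definition adjoin (A : F -> Prop) z x := exists a b, [/\ A a, A b & x = a + b * z].

Lemma sq_subfield_adjoin A z : sq_subfield A -> sq_subfield (adjoin A z).
Proof.
move=> sA; have A0 := sq_subfield0 sA; case: sA => sqA addA mulA; split.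
- by move=> x; exists (x ^+ 2), 0; split; rewrite ?mul0r ?addr0.
- move=> _ _ [a [b [Aa Ab ->]]] [a' [b' [Aa' Ab' ->]]].
  by exists (a + a'), (b + b'); split; [exact: addA | exact: addA | ring].
move=> _ _ [a [b [Aa Ab ->]]] [a' [b' [Aa' Ab' ->]]].
exists (a * a' + b * b' * z ^+ 2), (a * b' + b * a'); split; last by ring.
  by apply: addA; [exact: mulA | apply: (mulA); [exact: mulA | exact: sqA]].
by apply: addA; exact: mulA.
Qed.

(** A linear relation involves finitely many coefficients, so independence over the union of a chain
    reduces to independence over one member. *)
Lemma chain_seq (C : (F -> Prop) -> Prop) (s : seq F) :
  classical_sets.total_on C classical_sets.subset -> (exists X, C X) ->
  (forall x, x \in s -> exists2 X, C X & X x) ->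
  exists2 X, C X & forall x, x \in s -> X x.
Proof.
move=> totC [X0 CX0]; elim: s => [|y s IHs] sC; first by exists X0.
have [|X CX sX] := IHs; first by move=> x xs; apply: sC; rewrite inE xs orbT.
have [|Y CY Yy] := sC y; first by rewrite inE eqxx.
have [XY|YX] := totC _ _ CX CY.
  by exists Y => // x /predU1P[-> //|/sX/XY].
by exists X => // x /predU1P[->|/sX //]; apply: YX.
Qed.

Lemma maximal_sq_subfield :
  (forall c : 'I_m -> F, \sum_i c i ^+ 2 * d i = 0 -> forall i, c i = 0) ->
  exists A, [/\ sq_subfield A, free_over A &
    forall B, sq_subfield B -> free_over B -> (forall x, A x -> B x) ->
      forall x, B x -> A x].
Proof.
move=> freeK.
(* The first alternative accounts for the union of an empty chain. *)
pose good A := (forall x, ~ A x) \/ (sq_subfield A /\ free_over A).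
have [] := @classical_sets.Zorn_bigcup F good.
  move=> C Cgood totC.
  have [[X [CX [x Xx]]]|empty] := classic (exists X, C X /\ exists x, X x); last first.
    by left=> x [X CX Xx]; apply: empty; exists X; split=> //; exists x.
  have goodX Y y : C Y -> Y y -> sq_subfield Y /\ free_over Y.
    by move=> CY Yy; case: (Cgood Y CY) => // /(_ y).
  have [[sqX _ _] _] := goodX _ _ CX Xx.
  right; split; [split|].
  - by move=> y; exists X => //; exact: sqX.
  - move=> y z [Y CY Yy] [Z CZ Zz].
    have [YZ|ZY] := totC _ _ CY CZ.
      by exists Z => //; have [[_ addZ _] _] := goodX _ _ CZ Zz; apply: addZ => //; apply: YZ.
    by exists Y => //; have [[_ addY _] _] := goodX _ _ CY Yy; apply: addY => //; apply: ZY.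
  - move=> y z [Y CY Yy] [Z CZ Zz].
    have [YZ|ZY] := totC _ _ CY CZ.
      by exists Z => //; have [[_ _ mulZ] _] := goodX _ _ CZ Zz; apply: mulZ => //; apply: YZ.
    by exists Y => //; have [[_ _ mulY] _] := goodX _ _ CY Yy; apply: mulY => //; apply: ZY.
  move=> c cU c0 i.
  have [|y|Y CY cY] := chain_seq (s := [seq c j | j : 'I_m]) totC; first by exists X.
    by case/imageP => j _ ->; exact: cU.
  have cYj j : Y (c j) by apply/cY/image_f.
  by have [_ freeY] := goodX _ _ CY (cYj i); apply: freeY.
move=> A [goodA maxA].
pose K x := exists y : F, x = y ^+ 2.
have sK : sq_subfield K.
  split=> [x|_ _ [y ->] [z ->]|_ _ [y ->] [z ->]]; first by exists x.
    by exists (y + z); rewrite (sqrDF F2).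
  by exists (y * z); rewrite exprMn.
have fK : free_over K.
  move=> c cK; have [r rE] := fin_all_exists cK.
  move=> sum0 i; rewrite rE (freeK r) ?expr0n //.
  by rewrite -[RHS]sum0; apply: eq_bigr => j _; rewrite rE.
(* The maximal element cannot be empty, since [K] is [good] and would strictly contain it. *)
have [sA fA] : sq_subfield A /\ free_over A.
  case: goodA => // A0; case: (maxA K); last by right.
  by split=> [x /A0 //|KA]; apply: (A0 0); apply: KA; exists 0; rewrite expr0n.
exists A; split=> // B sB fB AB x Bx; apply: NNPP => nAx.
by case: (maxA B); [split=> // BA; apply/nAx/BA | right].
Qed.

(** For [z] outside [A], maximality yields a nontrivial relation over [A[z]], of the form
    [u + z * w = 0] with [u] and [w] in the [A]-span of the [d_i]. Then [z = (u * w^-2) * w], and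
    [w^-2] is a square, hence in [A]. *)
Lemma product_decomposition A : sq_subfield A -> free_over A -> (0 < m)%N ->
  (forall B, sq_subfield B -> free_over B -> (forall x, A x -> B x) ->
     forall x, B x -> A x) ->
  forall z, exists u w : 'I_m -> F, [/\ forall i, A (u i), forall i, A (w i) &
    z = (\sum_i u i * d i) * (\sum_i w i * d i)].
Proof.
move=> sA fA m0 maxA z; have A0 := sq_subfield0 sA.
have [sqA addA mulA] := sA.
have A1 : A 1 by have := sqA 1; rewrite expr1n.
have [Az|nAz] := classic (A z).
  pose i0 := Ordinal m0; pose dl i : F := (i == i0)%:R.
  have Adl i : A (dl i) by rewrite /dl; case: (i == i0).
  have sum_dl x : \sum_i x * dl i * d i = x * d i0.
    rewrite (bigD1 i0) //= /dl eqxx mulr1 big1 ?addr0 // => i /negPf ->.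
    by rewrite mulr0 mul0r.
  have d0 : d i0 != 0.
    apply/eqP => d0; have := fA dl Adl.
    under eq_bigr => i _ do rewrite -[dl i]mul1r.
    rewrite sum_dl d0 mulr0 => /(_ erefl i0)/eqP.
    by rewrite /dl eqxx oner_eq0.
  (* For [z] in [A], the factors are [z * d_i0^-2 * d_i0] and [d_i0]; dividing by a square keeps the
     coefficients in [A]. *)
  exists (fun i => z * (d i0)^-1 ^+ 2 * dl i), (fun i => 1 * dl i); split.
  - by move=> i; apply: (mulA) => //; apply: (mulA) => //; exact: sqA.
  - by move=> i; exact: mulA.
  by rewrite !sum_dl; field.
have nfree : ~ free_over (adjoin A z).
  move=> fAz; apply: nAz; apply: (maxA (adjoin A z)) => //.
  - exact: sq_subfield_adjoin.
  - by move=> x Ax; exists x, 0; split; rewrite ?mul0r ?addr0.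
  by exists 0, 1; split; rewrite ?mul1r ?add0r.
have [c [cA [c0 [i ci]]]] : exists c, (forall i, adjoin A z (c i)) /\
    (\sum_i c i * d i = 0 /\ exists i, c i <> 0).
  apply: NNPP => nex; apply: nfree => c cA c0 i; apply: NNPP => ci.
  by apply: nex; exists c; split=> //; split=> //; exists i.
have [a {}cA] := fin_all_exists cA.
have [b {}cA] := fin_all_exists cA.
have Aa j : A (a j) by case: (cA j).
have Ab j : A (b j) by case: (cA j).
have cE j : c j = a j + b j * z by case: (cA j).
pose u := \sum_j a j * d j; pose w := \sum_j b j * d j.
have uw : u + z * w = 0.
  rewrite -[RHS]c0 /u /w mulr_sumr -big_split; apply: eq_bigr => j _ /=.
  by rewrite cE; ring.
(* If [w = 0], independence over [A] kills all [b j], then all [a j], contradicting [c i <> 0]. *)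
have w0 : w != 0.
  apply/eqP => w0; apply: ci; rewrite cE (fA b Ab w0) mul0r addr0.
  by apply: fA => //; move: uw; rewrite w0 mulr0 addr0.
exists (fun j => a j * w^-1 ^+ 2), b; split=> [j||] //; first by apply: (mulA).
have -> : \sum_j a j * w^-1 ^+ 2 * d j = u * w^-1 ^+ 2.
  by rewrite /u mulr_suml; apply: eq_bigr => j _; ring.
have -> : u = z * w.
  by apply/eqP; rewrite -subr_eq0 (oppr_pchar2 F2) uw.
by rewrite -/w; field.
Qed.

End MaximalSubfield.

(** * The field as a finite extension of a chosen subfield *)

Section SubfieldType.
Variables (F : fieldType) (S : divringClosed F).

Record subfield_of := SubfieldOf { sf_val : F; _ : sf_val \in S }.

HB.instance Definition _ := [isSub for sf_val].
HB.instance Definition _ := [Choice of subfield_of by <:].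
HB.instance Definition _ := [SubChoice_isSubComUnitRing of subfield_of by <:].
HB.instance Definition _ := [SubComUnitRing_isSubIntegralDomain of subfield_of by <:].
HB.instance Definition _ := [SubIntegralDomain_isSubField of subfield_of by <:].

End SubfieldType.

Section ExtensionOfSubfield.
Variables (F : fieldType) (S : divringClosed F).

(** A copy of [F] whose type records [S], so that the scaling by [subfield_of S] can be inferred. *)
Definition ext_over of divringClosed F : Type := F.
Local Notation E := (ext_over S).
HB.instance Definition _ := GRing.Field.on E.

Definition ext_scale (a : subfield_of S) (u : E) : E := sf_val a * u.

Fact ext_scaleA a b u : ext_scale a (ext_scale b u) = ext_scale (a * b) u.
Proof. exact: mulrA. Qed.

Fact ext_scale1 u : ext_scale 1 u = u.
Proof. exact: mul1r. Qed.

Fact ext_scaleDr a u v : ext_scale a (u + v) = ext_scale a u + ext_scale a v.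
Proof. exact: mulrDr. Qed.

Fact ext_scaleDl v a b : ext_scale (a + b) v = ext_scale a v + ext_scale b v.
Proof. exact: mulrDl. Qed.

HB.instance Definition _ := GRing.Zmodule_isLmodule.Build _ E
  ext_scaleA ext_scale1 ext_scaleDr ext_scaleDl.

Fact ext_scaleAl a (u v : E) : ext_scale a (u * v) = (ext_scale a u) * v.
Proof. exact: mulrA. Qed.

HB.instance Definition _ := GRing.Lmodule_isLalgebra.Build _ E ext_scaleAl.

Fact ext_scaleAr a (u v : E) : ext_scale a (u * v) = u * (ext_scale a v).
Proof. exact: mulrCA. Qed.

HB.instance Definition _ := GRing.Lalgebra_isAlgebra.Build _ E ext_scaleAr.

End ExtensionOfSubfield.

Lemma basis_vector_axiom (L : fieldType) (V : lmodType L) N (g : 'I_N -> V) :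
  (forall v, exists c : 'I_N -> L, v = \sum_i c i *: g i) ->
  (forall c : 'I_N -> L, \sum_i c i *: g i = 0 -> forall i, c i = 0) ->
  inhabited (Vector.axiom N V).
Proof.
move=> span freeg; pose r2v (r : 'rV[L]_N) : V := \sum_i r 0 i *: g i.
have r2v_lin k u v : r2v (k *: u + v) = k *: r2v u + r2v v.
  rewrite /r2v scaler_sumr -big_split; apply: eq_bigr => i _.
  by rewrite !mxE scalerDl scalerA.
have r2v_inj : injective r2v.
  move=> u v uv; apply/rowP => i; apply/eqP; rewrite -subr_eq0; apply/eqP.
  have := freeg (fun j => (-1 *: v + u) 0 j); rewrite -[X in X = 0 -> _]/(r2v _).
  rewrite r2v_lin uv scaleN1r addNr => /(_ erefl i).
  by rewrite !mxE mulN1r addrC.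
have r2v_surj v : exists r, r2v r = v.
  have [c ->] := span v; exists (\row_i c i).
  by apply: eq_bigr => i _; rewrite mxE.
have [v2r v2rK] := boolp.choice r2v_surj.
constructor; exists v2r.
  by move=> k u v; apply: r2v_inj; rewrite r2v_lin !v2rK.
by exists r2v => // r; apply: r2v_inj; rewrite v2rK.
Qed.

Lemma spanning_vector_axiom (L : fieldType) (V : lmodType L) N (g : 'I_N -> V) :
  (forall v, exists c : 'I_N -> L, v = \sum_i c i *: g i) ->
  exists n, inhabited (Vector.axiom n V).
Proof.
elim: N g => [|N IHN] g span.
  by exists 0%N; apply: (basis_vector_axiom span) => c _ [].
have [freeg|nfree] := classic (forall c : 'I_N.+1 -> L,
  \sum_i c i *: g i = 0 -> forall i, c i = 0).
  by exists N.+1; apply: basis_vector_axiom freeg.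
have [c [c0 [i0 ci0]]] : exists c : 'I_N.+1 -> L,
    \sum_i c i *: g i = 0 /\ exists i, c i != 0.
  apply: NNPP => nex; apply: nfree => c c0 i; apply/eqP/negPn/negP => ci.
  by apply: nex; exists c; split=> //; exists i.
apply: (IHN (fun j => g (lift i0 j))) => v; have [b ->] := span v.
(* The relation [c] is solved for [g i0], which is then eliminated from the expansion of [v]. *)
exists (fun j => b (lift i0 j) - b i0 / c i0 * c (lift i0 j)).
under [RHS]eq_bigr => j _ do rewrite scalerBl -scalerA.
rewrite sumrB -scaler_sumr.
have -> : \sum_j c (lift i0 j) *: g (lift i0 j) = - (c i0 *: g i0).
  by apply/eqP; rewrite -addr_eq0 addrC; apply/eqP; rewrite -[RHS]c0 [RHS](bigD1_ord i0).
by rewrite scalerN opprK scalerA divfK // addrC [LHS](bigD1_ord i0).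
Qed.

Lemma sq_subfield_divringClosed (F : fieldType) (A : F -> Prop) :
  2%N \in [pchar F] -> sq_subfield A ->
  exists S : divringClosed F, forall x, A x <-> x \in S.
Proof.
move=> F2 [sqA addA mulA]; pose A' x := boolp.asbool (A x).
have divA : divring_closed A'.
  split.
  - by apply/boolp.asboolP; have := sqA 1; rewrite expr1n.
  - move=> x y /boolp.asboolP Ax /boolp.asboolP Ay; apply/boolp.asboolP.
    by rewrite (oppr_pchar2 F2); apply: addA.
  move=> x y /boolp.asboolP Ax /boolp.asboolP Ay; apply/boolp.asboolP.
  have -> : x / y = x * (y * y^-1 ^+ 2).
    by have [->|y0] := eqVneq y 0; [rewrite invr0 mul0r | field].
  by apply: (mulA) => //; apply: (mulA).
pose S : divringClosed F := HB.pack A' (GRing.isDivringClosed.Build F A' divA).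
by exists S => x; apply: rwP; apply: boolp.asboolP.
Qed.

(** * From the form to the extension over the maximal subfield *)

Theorem theorem4p2 (F : fieldType) (n : nat) (b : bform F) :
  2%N \in [pchar F] -> (0 < n)%N ->
  is_form b -> anisotropic b -> (bdim b < 2 ^ n.+1)%N ->
  in_In n b ->
  exists i : nat, [/\ (1 <= i)%N, (i <= n.+1)%N & bdim b = (2 ^ n.+1 - 2 ^ i)%N].
Proof.
move=> F2 n0 fb anis ltm bIn; pose m := bdim b.
have [m0|m_gt0] := posnP (bdim b); first by exists n.+1; rewrite subnn.
(* The identity has order 0 and [n] is positive, so the tensor of [b] annihilates it. At 1 this says
   that the trace, which is [bdim b], is zero in [F]. *)
have even_m : ~~ odd (bdim b).
  have id_sq : sq_linear (@id F) by [].
  have id_ord : order_lt (n + 0) (@id F).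
    by apply: (@order_lt_leq _ 1) => [|a x]; rewrite ?addn0 // subrr.
  have := tensor_act_In F2 fb bIn id_sq id_ord 1.
  suff -> : tensor_act b id 1 = (bdim b)%:R.
    by move=> /eqP; rewrite -(dvdn_pcharf F2) dvdn2.
  rewrite -(tensor_trace F2 fb).
  by apply: eq_bigr => i _; apply: eq_bigr => j _; rewrite mulr1.
pose d : 'I_m -> F := fun i => bmat b i i.
(* The sum is the value of the form at the vector [c], so anisotropy applies. *)
have freeK (c : 'I_m -> F) : \sum_i c i ^+ 2 * d i = 0 -> forall i, c i = 0.
  move=> sum0; suff /rowP c0 : \row_i c i = 0 by move=> i; have := c0 i; rewrite !mxE.
  apply/eqP; apply: contraT => /anis; case: (fb) => bs _.
  rewrite (diag_congr F2 _ _ bs) => /eqP[]; rewrite -[RHS]sum0.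
  by apply: eq_bigr => i _; rewrite mxE.
have [A [sA fA maxA]] := maximal_sq_subfield F2 freeK.
have prodA := product_decomposition F2 sA fA m_gt0 maxA.
have [S SP] := sq_subfield_divringClosed F2 sA.
have inS x : A x -> x \in S by move/SP.
pose L := subfield_of S.
have lift_S (u : 'I_m -> F) : (forall i, A (u i)) ->
    exists u' : 'I_m -> L, forall i, sf_val (u' i) = u i.
  by move=> Au; exists (fun i => SubfieldOf (inS _ (Au i))).
have prodL (z : ext_over S) : exists u w : 'I_m -> L,
    z = (\sum_i u i *: (d i : ext_over S)) * (\sum_i w i *: (d i : ext_over S)).
  have [u [w [/lift_S[u' uE] /lift_S[w' wE] ->]]] := prodA z.
  exists u', w'; congr (_ * _); apply: eq_bigr => i _.
    by rewrite -uE.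
  by rewrite -wE.
(* By the product decomposition the [m * m] products [d_i * d_j] span [F] over [L], which makes the
   extension finite. *)
pose g k : ext_over S := d (mxtens_unindex k).1 * d (mxtens_unindex k).2.
have [N [vecE]] : exists N, inhabited (Vector.axiom N (ext_over S)).
  apply: (spanning_vector_axiom (g := g)) => z; have [u [w ->]] := prodL z.
  exists (fun k => u (mxtens_unindex k).1 * w (mxtens_unindex k).2).
  rewrite big_mxtens mulr_suml; apply: eq_bigr => i _.
  rewrite mulr_sumr; apply: eq_bigr => j _.
  by rewrite /g mxtens_indexK -scalerAl -scalerAr scalerA.
pose E : fieldExtType L :=
  HB.pack (ext_over S) (Lmodule_hasFinDim.Build _ (ext_over S) vecE).
have Asq x : A (x ^+ 2) by case: (sA).
pose C : 'M[L]_m := \matrix_(i, j) SubfieldOf (inS _ (Asq (invmx (bmat b) i j))).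
have E2 : 2%N \in [pchar E] by [].
have E_sq (x : E) : x ^+ 2 \in 1%VS.
  apply/vlineP; exists (SubfieldOf (inS _ (Asq x))).
  by rewrite -[RHS]/(x ^+ 2 * 1) mulr1.
pose dE : 'I_m -> E := d.
have d_free (c : 'I_m -> L) : \sum_i c i *: dE i = 0 -> forall i, c i = 0.
  move=> c0 i; apply: val_inj; rewrite /=.
  apply: (fA (fun i => sf_val (c i))) => // j.
  by case: (c j) => x /= /SP.
apply: (@dim_gap L E E2 E_sq m dE d_free n C) => //.
(* Inside [F] the matrix [C] is the Frobenius image of the inverse Gram matrix. *)
- rewrite -(map_unitmx (\val : {rmorphism L -> F})).
  have -> : map_mx \val C = sqmx F2 (invmx (bmat b)).
    by apply/matrixP => i j; rewrite !mxE.
  by rewrite map_unitmx unitmx_inv; case: fb.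
- by rewrite mul2n -addnn; exact: (@dim_le_products L E E2 E_sq m dE prodL).
move=> k f flin ford.
have fsq : sq_linear (f : F -> F).
  by move=> c x y; apply: (flin (SubfieldOf (inS _ (Asq c)))).
apply: (@eq_order_lt E k (tensor_act b f)) => [x|].
  apply: eq_bigr => i _; apply: eq_bigr => j _.
  by rewrite mxE -[_%:A]/(_ * 1) mulr1.
exact: (tensor_act_In F2 fb bIn fsq ford).
Qed.
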